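(* Let $\Pi$ be a bicriteria minimization problem with positive-valued, polynomially computable objective functions. Given $0<\epsilon\leq 1$ and a polynomial-time $\alpha$-approximation algorithm $\mathrm{ALG}$ for the weighted sum problem $\Pi^{\mathrm{WS}}$, it is possible to obtain a bicriteria $\left(\alpha\cdot(1+2\epsilon),\ \alpha\cdot\left(1+\frac{2}{\epsilon}\right)\right)$-approximation algorithm for the budget-constrained problem $\Pi^{\mathrm{Budget}}$ with running time $\mathcal{O}\left(T_{\mathrm{ALG}}\cdot\frac{1}{\epsilon}\cdot\log_2\left(\frac{\mathrm{UB}(2)}{\mathrm{LB}(2)}\right)\right)$, where $T_{\mathrm{ALG}}$ denotes the running time of $\mathrm{ALG}$.
   Context: Bicriteria minimization problem $\Pi$: each instance $I$ has a set $S(I)$ of feasible solutions, and two objective functions to be minimized are given by polynomial-time algorithms $f_1,f_2$ that, given $I$ and $x\in S(I)$, compute positive rational numbers $f_1(I,x), f_2(I,x)$. For each instance $I$ and $i=1,2$ there are positive rationals $\mathrm{LB}(I,i),\mathrm{UB}(I,i)$, of encoding length polynomial in the encoding length $|I|$, with $\mathrm{LB}(I,i)\le f_i(I,x)\le \mathrm{UB}(I,i)$ for all $x\in S(I)$; these bounds may be used by the algorithms. The instance $I$ is dropped from the notation when clear (so $\mathrm{LB}(i)=\mathrm{LB}(I,i)$, $\mathrm{UB}(i)=\mathrm{UB}(I,i)$). Weighted sum problem $\Pi^{\mathrm{WS}}$: given an instance $I$ and a weight $\gamma>0$, find $x\in S(I)$ minimizing $f_1(I,x)+\gamma\cdot f_2(I,x)$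 over $S(I)$. Polynomial-time $\alpha$-approximation algorithm ($\alpha\ge 1$) for a minimization problem: an algorithm that, for any given instance, in time polynomial in the encoding length of the instance, finds a feasible solution with objective value at most $\alpha$ times the optimal objective value if a feasible solution exists, and outputs infeasibility otherwise. Budget-constrained problem $\Pi^{\mathrm{Budget}}$: given an instance $I$ of $\Pi$ and a budget $B>0$, find $x\in S(I)$ with $f_1(I,x)\le B$ minimizing $f_2(I,x)$ among all such solutions. (Polynomial-time) bicriteria $(\alpha',\beta')$-approximation algorithm ($\alpha',\beta'\ge1$) for $\Pi^{\mathrm{Budget}}$: an algorithm that, for any instance $I$ of $\Pi$ and any budget $B>0$, requires time polynomial in the encoding length of $I,B$ to find a solution $x\in S(I)$ such that: if there exists $x'\in S(I)$ with $f_1(I,x')\le B$, then $f_1(I,x)\le\alpha'\cdot B$ and $f_2(I,x)\le\beta'\cdot\mathrm{opt}(B)$, where $\mathrm{opt}(B)=\inf\{f_2(I,\tilde x):\tilde x\in S(I),\ f_1(I,\tilde x)\le B\}$.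
   Formalization: The bound uses max(1, log2(UB(2)/LB(2))), as the literal bound is 0 when UB(2)=LB(2), and T_ALG is a nondecreasing bound also covering reading the input and evaluating f_1, f_2 at ALG's solution; without this the claim fails when evaluation is slower than ALG. *)

(* Defs.v *)
From HB Require Import structures.
From mathcomp Require Import all_boot all_order all_algebra.
From mathcomp Require Import boolp classical_sets reals exp.

Set Implicit Arguments.
Unset Strict Implicit.
Unset Printing Implicit Defensive.

Import Order.TTheory GRing.Theory Num.Theory.

Local Open Scope nat_scope.

(* While-programs over registers holding natural numbers, with the logarithmic
    cost criterion of random access machines: a step is charged the binary
    lengths of the numbers it handles.  A program addresses finitely many
    registers; since these hold arbitrarily large numbers, the model is
    polynomially equivalent to Turing machines. *)

Definition bitlen (n : nat) : nat := (trunc_log 2 n).+1.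

Definition store := nat -> nat.

Inductive arith := Add | Sub | Mul | Div.

(* [Sub] is truncated at 0, and the quotient of any number by 0 is 0. *)
Definition arith_eval (o : arith) (a b : nat) : nat :=
  match o with
  | Add => a + b
  | Sub => a - b
  | Mul => a * b
  | Div => a %/ b
  end.

Inductive prog :=
| Const (r n : nat)
| Op (r : nat) (o : arith) (r1 r2 : nat)
| Seq (p q : prog)
| If (r : nat) (p q : prog)
| While (r : nat) (p : prog).

(* [exec p s s' t]: started in store [s], the program [p] halts in store [s']
   at total cost [t].  A register tests as true iff it is nonzero. *)
Inductive exec : prog -> store -> store -> nat -> Prop :=
| ExecConst r n s :
    exec (Const r n) s [eta s with r |-> n] (bitlen n)
| ExecOp r o r1 r2 s :
    exec (Op r o r1 r2) s [eta s with r |-> arith_eval o (s r1) (s r2)]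
      (bitlen (s r1) + bitlen (s r2))
| ExecSeq p q s s1 s2 t1 t2 :
    exec p s s1 t1 -> exec q s1 s2 t2 -> exec (Seq p q) s s2 (t1 + t2)
| ExecIfTrue r p q s s1 t :
    s r != 0 -> exec p s s1 t -> exec (If r p q) s s1 (bitlen (s r) + t)
| ExecIfFalse r p q s s1 t :
    s r == 0 -> exec q s s1 t -> exec (If r p q) s s1 (bitlen (s r) + t)
| ExecWhileTrue r p s s1 s2 t1 t2 :
    s r != 0 -> exec p s s1 t1 -> exec (While r p) s1 s2 t2 ->
    exec (While r p) s s2 (bitlen (s r) + t1 + t2)
| ExecWhileFalse r p s :
    s r == 0 -> exec (While r p) s s (bitlen (s r)).

Lemma exec_det p s s1 s2 t1 t2 :
  exec p s s1 t1 -> exec p s s2 t2 -> s1 = s2 /\ t1 = t2.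
Proof.
move=> H; elim: H s2 t2 => {p s s1 t1};
  intros; match goal with E : exec _ _ ?s' ?t' |- _ = ?s' /\ _ = ?t' =>
    inversion E; subst end;
  repeat match goal with
  | IH : forall s2 t2, exec ?p ?s s2 t2 -> _, E : exec ?p ?s _ _ |- _ =>
      case: (IH _ _ E) => ? ?; subst; clear E
  end; try by [];
  by match goal with F : is_true (?x == _), G : is_true (?x != _) |- _ =>
    rewrite F in G end.
Qed.

(* The input occupies the first registers; all the others are initially 0.  The
   output is read off the first registers. *)
Definition load (xs : seq nat) : store := fun r => nth 0 xs r.

Definition returns (p : prog) (xs ys : seq nat) (t : nat) : Prop :=
  exists s, exec p (load xs) s t /\ forall i, i < size ys -> s i = nth 0 ys i.

Definition runtime (p : prog) (xs : seq nat) (t : nat) : Prop :=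
  exists s, exec p (load xs) s t.

Definition codelen (xs : seq nat) : nat := \sum_(x <- xs) bitlen x.

(* Used for positive rationals only: numerator and denominator in lowest terms. *)
Definition rat_code (q : rat) : seq nat := [:: `|numq q|%N; `|denq q|%N].

Definition rat_len (q : rat) : nat := codelen (rat_code q).

Local Open Scope ring_scope.
Local Open Scope classical_set_scope.

Inductive criterion := C1 | C2.

(* Instances and solutions are identified with natural numbers (bit strings)
   through arbitrary injective encodings. *)
Record bicriteria_problem := BicriteriaProblem {
  inst : Type;
  sol : Type;
  inst_enc : inst -> nat;
  sol_enc : sol -> nat;
  inst_enc_inj : injective inst_enc;
  sol_enc_inj : injective sol_enc;
  feasible : inst -> set sol;
  obj : criterion -> inst -> sol -> rat;
  obj_gt0 : forall i I x, feasible I x -> 0 < obj i I x;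
  obj_prog : criterion -> prog;
  obj_polytime : forall i, exists q : {poly nat}, forall I x, feasible I x ->
    exists2 t : nat,
      returns (obj_prog i) [:: inst_enc I; sol_enc x] (rat_code (obj i I x)) t &
      (t <= q.[(bitlen (inst_enc I) + bitlen (sol_enc x))%N])%N;
  LB : criterion -> inst -> rat;
  UB : criterion -> inst -> rat;
  LB_gt0 : forall i I, 0 < LB i I;
  UB_gt0 : forall i I, 0 < UB i I;
  LB_UB_len : forall i, exists q : {poly nat}, forall I,
    (rat_len (LB i I) <= q.[bitlen (inst_enc I)])%N /\
    (rat_len (UB i I) <= q.[bitlen (inst_enc I)])%N;
  LB_obj_UB : forall i I x, feasible I x -> LB i I <= obj i I x <= UB i I
}.

Definition inst_len (Pi : bicriteria_problem) (I : inst Pi) : nat :=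
  bitlen (inst_enc I).

(* Algorithms receive the bounds together with the instance: the bounds may be
   used even though they are not assumed to be computable. *)
Definition inst_code (Pi : bicriteria_problem) (I : inst Pi) : seq nat :=
  inst_enc I :: rat_code (LB C1 I) ++ rat_code (UB C1 I)
             ++ rat_code (LB C2 I) ++ rat_code (UB C2 I).

(* Common input format of the two scalar problems: an instance together with a
   positive rational, which is the weight or the budget, respectively. *)
Definition input (Pi : bicriteria_problem) (I : inst Pi) (q : rat) : seq nat :=
  inst_code I ++ rat_code q.

(* [None] stands for the output ``infeasible''. *)
Definition sol_code (Pi : bicriteria_problem) (o : option (sol Pi)) : seq nat :=
  if o is Some x then [:: 1%N; sol_enc x] else [:: 0%N].

Definition ws_obj (Pi : bicriteria_problem) (I : inst Pi) (gamma : rat)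
    (x : sol Pi) : rat :=
  obj C1 I x + gamma * obj C2 I x.

Definition ws_opt (R : realType) (Pi : bicriteria_problem) (I : inst Pi)
    (gamma : rat) : R :=
  inf [set (ratr (ws_obj I gamma x) : R) | x in feasible I].

Definition ws_approx (R : realType) (Pi : bicriteria_problem) (alpha : R)
    (A : prog) : Prop :=
  1 <= alpha /\
  exists q : {poly nat}, forall (I : inst Pi) (gamma : rat), 0 < gamma ->
  exists (o : option (sol Pi)) (t : nat),
    [/\ returns A (input I gamma) (sol_code o) t,
        (t <= q.[(inst_len I + rat_len gamma)%N])%N &
        if o is Some x then
          feasible I x /\ ratr (ws_obj I gamma x) <= alpha * ws_opt R I gamma
        else feasible I = set0].

(* [T] bounds the running time of [A], as a function of the encoding length of
   the input, where reading the input and evaluating the two objective functions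
   at the solution returned are taken not to be more expensive than [A] itself.
   [T] is otherwise arbitrary, so that for a faster [A] one may take the sum of
   the time bounds of [A] and of these auxiliary computations. *)
Definition ws_time (Pi : bicriteria_problem) (A : prog) (T : nat -> nat) : Prop :=
  {homo T : m n / (m <= n)%N} /\
  forall (I : inst Pi) (gamma : rat), 0 < gamma ->
  let n := codelen (input I gamma) in
  [/\ (n <= T n)%N,
      forall t, runtime A (input I gamma) t -> (t <= T n)%N &
      forall (x : sol Pi) (t : nat), feasible I x ->
        returns A (input I gamma) (sol_code (Some x)) t ->
        forall i t', runtime (obj_prog Pi i) [:: inst_enc I; sol_enc x] t' ->
        (t' <= T n)%N].

Definition budget_opt (R : realType) (Pi : bicriteria_problem) (I : inst Pi)
    (B : rat) : R :=
  inf [set (ratr (obj C2 I x) : R) | x in [set x | feasible I x /\ obj C1 I x <= B]].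

(* As no solution can be returned when there is none, ``infeasible'' is then
   (and only then) the required output. *)
Definition budget_approx (R : realType) (Pi : bicriteria_problem)
    (alpha beta : R) (A : prog) : Prop :=
  1 <= alpha /\ 1 <= beta /\
  exists q : {poly nat}, forall (I : inst Pi) (B : rat), 0 < B ->
  exists (o : option (sol Pi)) (t : nat),
    [/\ returns A (input I B) (sol_code o) t,
        (t <= q.[(inst_len I + rat_len B)%N])%N &
        if o is Some x then
          feasible I x /\
          ((exists x', feasible I x' /\ obj C1 I x' <= B) ->
           ratr (obj C1 I x) <= alpha * ratr B /\
           ratr (obj C2 I x) <= beta * budget_opt R I B)
        else feasible I = set0].

Definition log2 (R : realType) (x : R) : R := ln x / ln 2.

(* Main.v *)
(** Let [v] be the value [f2 x'] of a solution [x'] that meets the budget.  With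
    weight [gamma], the answer [x] of the weighted sum algorithm satisfies
    [f1 x + gamma * f2 x <= alpha * (B + gamma * v)].  For [gamma] about
    [eps * B / u], this gives the bound on [f2 x] as soon as [u <= v], and the bound
    on [f1 x] as soon as [v <= 3/2 * u].  Try [u = LB 2 * (3/2)^i] for [i = 0, 1, ...]
    until the answer meets the bound on [f1] or [u > UB 2]: as long as answers are
    rejected, [u <= v], so the first accepted answer is good.  The test needs no [v],
    and as [alpha] and [eps] may be irrational it uses a rational between what is
    guaranteed and what is required.

    To run in time proportional to that of [ALG], the reduction must avoid reducing
    fractions, and its numbers may gain only O(1) bits per iteration. *)

Require Import Defs.
From mathcomp Require Import all_boot all_order all_algebra.
From mathcomp Require Import zify ring lra.
From mathcomp Require Import boolp classical_sets reals exp.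

Set Implicit Arguments.
Unset Strict Implicit.
Unset Printing Implicit Defensive.

Import Order.TTheory GRing.Theory Num.Theory.
Local Open Scope nat_scope.

(** * Binary lengths and execution *)

Lemma bitlen_gt0 n : 0 < bitlen n. Proof. by []. Qed.

Lemma ltn_bitlen n : n < 2 ^ bitlen n.
Proof. exact: trunc_log_ltn. Qed.

Lemma bitlen_leq n k : 0 < k -> n < 2 ^ k -> bitlen n <= k.
Proof.
move=> k0 nk; case: n nk => [|n] nk; first by rewrite /bitlen trunc_log0.
rewrite /bitlen -(@ltn_exp2l 2) //; apply: leq_ltn_trans nk.
exact: trunc_logP.
Qed.

Lemma leq_bitlen m n : m <= n -> bitlen m <= bitlen n.
Proof. by move=> mn; rewrite ltnS leq_trunc_log. Qed.

Lemma bitlen_expn k : bitlen (2 ^ k) = k.+1.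
Proof. by rewrite /bitlen trunc_expnK. Qed.

Lemma bitlen_muln a b : bitlen (a * b) <= bitlen a + bitlen b.
Proof.
apply: bitlen_leq => //; rewrite expnD.
exact: ltn_mul (ltn_bitlen a) (ltn_bitlen b).
Qed.

Lemma bitlen_addn a b : bitlen (a + b) <= (maxn (bitlen a) (bitlen b)).+1.
Proof.
apply: bitlen_leq => //; rewrite expnS mul2n -addnn.
have a_lt := ltn_bitlen a; have b_lt := ltn_bitlen b.
have Ha : 2 ^ bitlen a <= 2 ^ maxn (bitlen a) (bitlen b).
  by rewrite leq_exp2l ?leq_maxl.
have Hb : 2 ^ bitlen b <= 2 ^ maxn (bitlen a) (bitlen b).
  by rewrite leq_exp2l ?leq_maxr.
lia.
Qed.

Lemma bitlen_arith o a b : bitlen (arith_eval o a b) <= bitlen a + bitlen b.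
Proof.
have a0 := bitlen_gt0 a; have b0 := bitlen_gt0 b.
case: o => /=.
- by apply: leq_trans (bitlen_addn _ _) _; lia.
- by apply: leq_trans (leq_bitlen (leq_subr _ _)) _; lia.
- exact: bitlen_muln.
- by apply: leq_trans (leq_bitlen (leq_div _ _)) _; lia.
Qed.

Definition bounded (L : nat) (s : store) := forall r, bitlen (s r) <= L.

Lemma boundedW L L' s : L <= L' -> bounded L s -> bounded L' s.
Proof. by move=> LL' sL r; apply: leq_trans LL'. Qed.

(* A step is charged for its operands, hence also for its result. *)
Lemma bitlen_exec p s s' t r :
  exec p s s' t -> bitlen (s' r) <= maxn (bitlen (s r)) t.
Proof.
elim=> {p s s' t} /=; intros; try case: eqVneq; rewrite ?leq_max ?leqnn ?orbT //=.
- by move=> _; rewrite bitlen_arith orbT.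
all: try lia.
Qed.

Lemma bounded_exec p s s' t L :
  exec p s s' t -> bounded L s -> bounded (maxn L t) s'.
Proof.
move=> E sL r; apply: leq_trans (bitlen_exec r E) _.
by rewrite geq_max !leq_max sL leqnn orbT.
Qed.

Fixpoint regs (p : prog) : nat :=
  match p with
  | Const r _ => r.+1
  | Op r _ r1 r2 => maxn r.+1 (maxn r1.+1 r2.+1)
  | Seq p q => maxn (regs p) (regs q)
  | If r p q => maxn r.+1 (maxn (regs p) (regs q))
  | While r p => maxn r.+1 (regs p)
  end.

Lemma exec_regs p s s' t r : exec p s s' t -> regs p <= r -> s' r = s r.
Proof.
elim=> {p s s' t} //=; intros.
- by case: eqVneq => // rE; lia.
- by case: eqVneq => // rE; lia.
- by rewrite H2 ?H0 //; lia.
- by rewrite H1 //; lia.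
- by rewrite H1 //; lia.
- by rewrite H3 ?H1 //; lia.
Qed.

Fixpoint shift (d : nat) (p : prog) : prog :=
  match p with
  | Const r n => Const (d + r) n
  | Op r o r1 r2 => Op (d + r) o (d + r1) (d + r2)
  | Seq p q => Seq (shift d p) (shift d q)
  | If r p q => If (d + r) (shift d p) (shift d q)
  | While r p => While (d + r) (shift d p)
  end.

Lemma exec_shift d M p s s' t s0 :
  exec p s s' t -> regs p <= M -> (forall r, r < M -> s0 (d + r) = s r) ->
  exists s0', [/\ exec (shift d p) s0 s0' t,
    forall r, r < M -> s0' (d + r) = s' r & forall r, r < d -> s0' r = s0 r].
Proof.
move=> E; elim: E s0 => {p s s' t} /=.
- move=> r n s s0 rM s0E; eexists; split; first exact: ExecConst.
    by move=> r' r'M /=; rewrite eqn_add2l s0E.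
  by move=> r' r'd /=; case: eqP => // ?; lia.
- move=> r o r1 r2 s s0 rM s0E; eexists; split.
  + by rewrite -(s0E r1) -?(s0E r2); [exact: ExecOp| lia| lia].
  + by move=> r' r'M /=; rewrite eqn_add2l !s0E //; lia.
  + by move=> r' r'd /=; case: eqP => // ?; lia.
- move=> p q s s1 s2 t1 t2 _ IH1 _ IH2 s0 rM s0E.
  have [|s01 [E1 A1 B1]] := IH1 s0 _ s0E; first by lia.
  have [|s02 [E2 A2 B2]] := IH2 s01 _ A1; first by lia.
  exists s02; split=> //; first exact: ExecSeq E1 E2.
  by move=> r rd; rewrite B2 ?B1.
- move=> r p q s s1 t sr _ IH s0 rM s0E.
  have [|s01 [E1 A1 B1]] := IH s0 _ s0E; first by lia.
  exists s01; split=> //; rewrite -(s0E r); last by lia.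
  by apply: ExecIfTrue => //; rewrite s0E //; lia.
- move=> r p q s s1 t sr _ IH s0 rM s0E.
  have [|s01 [E1 A1 B1]] := IH s0 _ s0E; first by lia.
  exists s01; split=> //; rewrite -(s0E r); last by lia.
  by apply: ExecIfFalse => //; rewrite s0E //; lia.
- move=> r p s s1 s2 t1 t2 sr _ IH1 _ IH2 s0 rM s0E.
  have [|s01 [E1 A1 B1]] := IH1 s0 _ s0E; first by lia.
  have [|s02 [E2 A2 B2]] := IH2 s01 _ A1; first by lia.
  exists s02; split=> //; last by move=> r' rd; rewrite B2 ?B1.
  rewrite -(s0E r); last by lia.
  by apply: ExecWhileTrue E1 E2; rewrite s0E //; lia.
- move=> r p s sr s0 rM s0E; exists s0; split=> //.
  rewrite -(s0E r); last by lia.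
  by apply: ExecWhileFalse; rewrite s0E //; lia.
Qed.

Lemma exec_while r p (Inv : nat -> store -> Prop) (Post : store -> Prop) J C :
  (forall i s, Inv i s -> s r != 0 /\ i < J) ->
  (forall i s, Inv i s -> exists s' t, [/\ exec p s s' t, bitlen (s r) + t <= C &
     Inv i.+1 s' \/ s' r = 0 /\ Post s']) ->
  forall s, Inv 0 s -> exists n s0 s' t,
    [/\ exec (While r p) s s' t, Post s', Inv n s0 & t <= n.+2 * C].
Proof.
move=> InvJ Hp s Is.
suff: forall k i s, J - i <= k -> Inv i s -> exists n s0 s' t,
    [/\ exec (While r p) s s' t, Post s', Inv (i + n) s0 & t <= n.+2 * C].
  by move=> /(_ (J - 0) 0 s (leqnn _) Is).
elim=> [|k IH] i {Is}s ik Is.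
  by have [_ iJ] := InvJ _ _ Is; lia.
have [sr iJ] := InvJ _ _ Is.
have [s' [t [E tC [Is'|[s'r Ps']]]]] := Hp _ _ Is.
- have [|n [s0 [s2 [t2 [E2 Ps2 I0 t2C]]]]] := IH _ _ _ Is'; first by lia.
  exists n.+1, s0, s2, (bitlen (s r) + t + t2); split=> //.
  + exact: ExecWhileTrue E E2.
  + by rewrite addnS -addSn.
  + by rewrite mulSn; lia.
- exists 0, s, s', (bitlen (s r) + t + bitlen (s' r)); split=> //.
  + by apply: ExecWhileTrue E _ => //; apply: ExecWhileFalse; rewrite s'r.
  + by rewrite addn0.
  + by rewrite s'r mulSn mul1n leq_add //; apply: leq_trans tC; rewrite addnC ltn_addl.
Qed.

Fixpoint loopfree (p : prog) : bool :=
  match p with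
  | Const _ _ | Op _ _ _ _ => true
  | Seq p q | If _ p q => loopfree p && loopfree q
  | While _ _ => false
  end.

Fixpoint run (p : prog) (s : store) : store :=
  match p with
  | Const r n => [eta s with r |-> n]
  | Op r o r1 r2 => [eta s with r |-> arith_eval o (s r1) (s r2)]
  | Seq p q => run q (run p s)
  | If r p q => if s r != 0 then run p s else run q s
  | While _ _ => s
  end.

Fixpoint factor (p : prog) : nat :=
  match p with
  | Const _ n => bitlen n
  | Op _ _ _ _ => 2
  | Seq p q => factor p + factor q * (1 + factor p)
  | If _ p q => 1 + factor p + factor q
  | While _ _ => 0
  end.

Lemma exec_run p L s : loopfree p -> bounded L s ->
  exists2 t, exec p s (run p s) t & t <= factor p * L.
Proof.
elim: p L s => //=.
- move=> r n L s _ sL; exists (bitlen n); first exact: ExecConst.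
  by rewrite leq_pmulr //; apply: leq_trans (sL 0).
- move=> r o r1 r2 L s _ sL; eexists; first exact: ExecOp.
  by rewrite mul2n -addnn leq_add.
- move=> p IHp q IHq L s /andP[lp lq] sL.
  have [t E tC] := IHp _ _ lp sL.
  have sL1 : bounded ((1 + factor p) * L) (run p s).
    by apply: boundedW (bounded_exec E sL); lia.
  have [t1 E1 t1C] := IHq _ _ lq sL1.
  exists (t + t1); first exact: ExecSeq E E1.
  by rewrite mulnDl leq_add // -mulnA.
- move=> r p IHp q IHq L s /andP[lp lq] sL.
  have rL := sL r.
  case: (eqVneq (s r) 0) => sr /=.
  + have [t E tC] := IHq _ _ lq sL; exists (bitlen (s r) + t).
      by apply: ExecIfFalse E; rewrite sr.
    by lia.
  + have [t E tC] := IHp _ _ lp sL; exists (bitlen (s r) + t).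
      exact: ExecIfTrue E.
    by lia.
Qed.

(** * The program *)

Local Notation rZ := 11 (only parsing).
Local Notation rp := 12 (only parsing).
Local Notation ra := 13 (only parsing).
Local Notation rP := 14 (only parsing).
Local Notation rQ := 15 (only parsing).
Local Notation rV := 16 (only parsing).
Local Notation rW := 17 (only parsing).
Local Notation rc := 18 (only parsing).
Local Notation rgn := 19 (only parsing).
Local Notation rgd := 20 (only parsing).
Local Notation rf := 21 (only parsing).
Local Notation rx := 22 (only parsing).
Local Notation rt := 23 (only parsing).
Local Notation ru := 24 (only parsing).
Local Notation D := 32 (only parsing).

Local Notation "p ;; q" := (Seq p q) (at level 61, right associativity).

Fixpoint clear (d k : nat) : prog :=
  if k is k'.+1 then Const (d + k') 0 ;; clear d k' else Const rZ 0.

Lemma loopfree_clear d k : loopfree (clear d k).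
Proof. by elim: k => [|k IH] /=. Qed.

Lemma run_clear d k s r :
  run (clear d k) s r = if (d <= r < d + k) || (r == rZ) then 0 else s r.
Proof.
elim: k s => [|k IH] s /=.
  by rewrite addn0; case: (r == rZ); rewrite ?orbT // orbF; case: ifP => //; lia.
rewrite IH /= addnS ltnS; case: (eqVneq r (d + k)) => [->|rdk].
  by rewrite leq_addr leqnn /= if_same.
by rewrite (leq_eqVlt r) (negPf rdk).
Qed.

Lemma exec_clear d k s : exec (clear d k) s (run (clear d k) s) k.+1.
Proof.
elim: k s => [|k IH] s /=; first exact: (ExecConst rZ 0 s).
rewrite -[k.+2]/(1 + k.+1); apply: ExecSeq; last exact: IH.
exact: (ExecConst (d + k) 0 s).
Qed.

Fixpoint copy (d : nat) (rs : seq nat) : prog :=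
  if rs is r :: rs' then Op d Add r rZ ;; copy d.+1 rs' else Const rZ 0.

Lemma loopfree_copy d rs : loopfree (copy d rs).
Proof. by elim: rs d => [|r rs IH] d /=. Qed.

Lemma run_copy d rs s r :
  rZ < d -> all (fun x => x < d) rs -> s rZ = 0 ->
  run (copy d rs) s r =
    if d <= r < d + size rs then s (nth 0 rs (r - d)) else s r.
Proof.
elim: rs d s => [|x rs IH] d s /= Zd; first by rewrite addn0 => _ sZ;
  case: (eqVneq r rZ) => [->|_]; case: ifP => //; lia.
case/andP=> xd rsd sZ; rewrite IH; last 1 first.
- by rewrite /=; case: eqP => //; lia.
- rewrite /= addnS addSn; case: (ltngtP d r) => [dr|rd|<-] /=.
  + case: ifP => // rs_lt.
    have -> : r - d = (r - d.+1).+1 by lia.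
    rewrite /=; case: eqP => // nthE.
    have lt_rs : r - d.+1 < size rs by lia.
    by have := allP rsd _ (mem_nth 0 lt_rs); rewrite nthE ltnn.
  + by [].
  + by rewrite sZ addn0 subnn ltnS leq_addr.
- by apply: leq_trans Zd _.
- by apply: sub_all rsd => y yd; apply: ltnW.
Qed.

Definition call_setup (p : prog) (rs : seq nat) : prog :=
  clear D (regs p).+2 ;; copy D rs.

Definition call (p : prog) (rs : seq nat) : prog :=
  call_setup p rs ;; shift D p.

Lemma exec_call p rs s ys t L :
  all (fun r => r < D) rs -> s rZ = 0 -> size ys <= 2 -> bounded L s ->
  returns p (map s rs) ys t ->
  exists s' t', [/\ exec (call p rs) s s' t',
    forall r, r < D -> s' r = s r,
    forall i, i < size ys -> s' (D + i) = nth 0 ys i &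
    t' <= factor (call_setup p rs) * L + t].
Proof.
move=> rsD sZ ys2 sL [s1 [E s1E]].
have lf : loopfree (call_setup p rs) by rewrite /= loopfree_clear loopfree_copy.
have [t0 E0 t0L] := exec_run lf sL.
have runE r : run (call_setup p rs) s r =
    if D <= r < D + size rs then s (nth 0 rs (r - D))
    else if D <= r < D + (regs p).+2 then 0 else s r.
  have clE r' : run (clear D (regs p).+2) s r' =
      if D <= r' < D + (regs p).+2 then 0 else s r'.
    by rewrite run_clear; case: (eqVneq r' rZ) => [->|]; rewrite ?orbF //= sZ.
  rewrite -[run _ s]/(run (copy D rs) (run (clear D (regs p).+2) s)).
  rewrite run_copy //; last by rewrite clE.
  rewrite !clE; case: ifP => // rs_lt; case: ifP => //.
  have lt_rs : r - D < size rs by lia.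
  by rewrite leqNgt (allP rsD _ (mem_nth 0 lt_rs)).
have [| |s' [E' s'E s'D]] :=
    @exec_shift D (regs p).+2 _ _ _ _ (run (call_setup p rs) s) E.
- by lia.
- move=> r rM; rewrite runE /load !leq_addr !ltn_add2l rM addKn /=.
  case: ltnP => rsz; first by rewrite (nth_map 0).
  by rewrite nth_default // size_map.
exists s', (t0 + t); split.
- exact: ExecSeq E0 E'.
- by move=> r rD; rewrite s'D // runE leqNgt rD.
- by move=> i iys; rewrite s'E ?s1E //; lia.
- by rewrite leq_add2r.
Qed.

(* The target weight is [P / Q] = [(5 / p) * B / u] with [5 / p] about [eps], and
   [V <= W] says that [u <= UB 2].
   The registers 0 to 10 hold the input: the instance, the numerators and
   denominators of LB(1), UB(1), LB(2), UB(2), and those of the budget. *)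
Definition init : prog :=
  Const rc 5 ;; Op rP Mul rc 9 ;; Op rP Mul rP 6 ;;
  Op rQ Mul rp 10 ;; Op rQ Mul rQ 5 ;;
  Op rW Mul 7 6 ;; Op rV Mul 8 5 ;;
  Const rc 1.

Definition weight_code : prog :=
  Op rgn Div rP rQ ;;
  If rgn (Const rgd 1)
         (Const rgn 1 ;; Op rgd Div rQ rP ;; Op rgd Add rgd rgn).

(* Accepts when [f1 x <= a / (2 * p) * B], and otherwise multiplies [u] by 3/2. *)
Definition accept : prog :=
  Op rt Mul D rp ;; Const ru 2 ;; Op rt Mul rt ru ;; Op rt Mul rt 10 ;;
  Op ru Mul ra 9 ;; Op ru Mul ru D.+1 ;; Op rt Defs.Sub rt ru ;;
  Const ru 2 ;; Op rP Mul rP ru ;; Op rW Mul rW ru ;;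
  Const ru 3 ;; Op rQ Mul rQ ru ;; Op rV Mul rV ru ;;
  If rt (Const rc 1 ;; Op rc Add rW rc ;; Op rc Defs.Sub rc rV) (Const rc 0).

Definition save : prog := Op rf Add D rZ ;; Op rx Add D.+1 rZ.

Definition step (ALG f1 : prog) : prog :=
  weight_code ;; call ALG [:: 0; 1; 2; 3; 4; 5; 6; 7; 8; rgn; rgd] ;;
  save ;; If rf (call f1 [:: 0; rx] ;; accept) (Const rc 0).

(* Clearing the scratch registers bounds the numbers held by them, whatever the
   preceding iterations left there. *)
Definition body (ALG f1 : prog) : prog :=
  clear rgn (regs (step ALG f1)) ;; step ALG f1.

Definition main_prog (ALG f1 : prog) : prog :=
  init ;; While rc (body ALG f1) ;; Op 0 Add rf rZ ;; Op 1 Add rx rZ.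

Definition budget_prog (ALG f1 : prog) (p a : nat) : prog :=
  Const rp p ;; Const ra a ;; main_prog ALG f1.

(** * Weights *)

Local Open Scope ring_scope.

Local Notation num q := (`|numq q|%N).
Local Notation den q := (`|denq q|%N).

Lemma rat_code_nat n : rat_code n%:R = [:: n; 1%N].
Proof. by rewrite /rat_code pmulrn numq_int denq_int. Qed.

Lemma rat_code_invS n : rat_code n.+1%:R^-1 = [:: 1%N; n.+1].
Proof.
have cop : coprime `|1%Z| `|n.+1%:Z| by rewrite /= coprime1n.
have := coprimeq_num cop; have := coprimeq_den cop.
by rewrite !mul1r /rat_code => -> ->.
Qed.

Lemma num_gt0 q : 0 < q -> (0 < num q)%N.
Proof. by move=> q0; rewrite absz_gt0 numq_eq0 gt_eqF. Qed.

Lemma den_gt0 q : (0 < den q)%N.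
Proof. by rewrite absz_gt0 denq_neq0. Qed.

Lemma ratr_num_den (F : numFieldType) q : 0 < q ->
  ratr q = (num q)%:R / (den q)%:R :> F.
Proof.
by move=> q0; rewrite !natr_absz !ger0_norm ?denq_ge0 ?numq_ge0 ?ltW.
Qed.

(* This approximation of P / Q is in lowest terms by construction: computing a
   greatest common divisor would exceed the time bound. *)
Definition weight (P Q : nat) : rat :=
  if (P %/ Q)%N == 0%N then (Q %/ P).+1%:R^-1 else (P %/ Q)%:R.

Lemma weight_gt0 P Q : 0 < weight P Q.
Proof.
by rewrite /weight; case: eqVneq => PQ; rewrite ?invr_gt0 ltr0n // lt0n.
Qed.

Lemma rat_code_weight P Q : rat_code (weight P Q) =
  if (P %/ Q)%N == 0%N then [:: 1; (Q %/ P).+1]%N else [:: (P %/ Q)%N; 1]%N.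
Proof. by rewrite /weight; case: ifP; rewrite ?rat_code_invS ?rat_code_nat. Qed.

Lemma weight_bounds (R : numFieldType) P Q : (0 < P)%N -> (0 < Q)%N ->
  P%:R / Q%:R <= 2 * ratr (weight P Q) :> R /\ ratr (weight P Q) <= P%:R / Q%:R :> R.
Proof.
move=> P0 Q0; have P0' : 0 < P%:R :> R by rewrite ltr0n.
have Q0' : 0 < Q%:R :> R by rewrite ltr0n.
rewrite /weight; case: eqVneq => [PQ|PQ].
- rewrite fmorphV rmorph_nat ler_pdivrMr // mulrAC ler_pdivlMr ?ltr0n //.
  rewrite -[X in _ /\ X <= _]mul1r ler_pdivrMr ?ltr0n // mulrAC ler_pdivlMr //.
  rewrite mul1r -!natrM !ler_nat.
  have QP : (P < Q)%N by move/eqP: PQ; rewrite -leqn0 leqNgt divn_gt0 // -ltnNge.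
  have := leq_trunc_div Q P; have := ltn_ceil Q P0.
  have : (0 < Q %/ P)%N by rewrite divn_gt0 // ltnW.
  move: (Q %/ P)%N => k; nia.
- rewrite ratr_nat ler_pdivrMr // ler_pdivlMr // -!natrM !ler_nat.
  have := leq_trunc_div P Q; have := ltn_ceil P Q0.
  have : (0 < P %/ Q)%N by rewrite lt0n.
  move: (P %/ Q)%N => k; nia.
Qed.

Lemma run_weight s :
  [:: run weight_code s rgn; run weight_code s rgd] = rat_code (weight (s rP) (s rQ)) /\
  forall r, r != rgn -> r != rgd -> run weight_code s r = s r.
Proof.
split; first by rewrite rat_code_weight /=; case: eqVneq => /= PQ; rewrite ?addn1.
by move=> r /negPf r1 /negPf r2 /=; case: ifP => _ /=; rewrite ?r1 ?r2.
Qed.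

Lemma run_accept s : let s' := run accept s in
  [/\ s' rP = (s rP * 2)%N, s' rQ = (s rQ * 3)%N,
      s' rV = (s rV * 3)%N, s' rW = (s rW * 2)%N &
      s' rc = if (s D * s rp * 2 * s 10 <= s ra * s 9 * s D.+1)%N then 0%N
              else (s rW * 2 + 1 - s rV * 3)%N].
Proof. by split=> /=; rewrite -?subn_eq0; case: eqP. Qed.

Lemma ratio_f2 (R : realFieldType) (alpha eps p f1 f2 b u v g : R) :
  1 <= alpha -> 0 < eps -> 0 < p -> 0 < b -> 0 < u -> u <= v ->
  5 / p * (b / u) <= 2 * g -> 0 < f1 -> p * eps <= 5 ->
  f1 + g * f2 <= alpha * (b + g * v) -> f2 <= alpha * (1 + 2 / eps) * v.
Proof.
move=> alpha_ge1 eps_gt0 p_gt0 b_gt0 u_gt0 uv g_ge f1_gt0 peps approx.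
have v_gt0 := lt_le_trans u_gt0 uv.
have y_gt0 : 0 < 5 / p * (b / u) by rewrite !mulr_gt0 ?invr_gt0.
have g_gt0 : 0 < g by lra.
rewrite -(ler_pM2l g_gt0).
have bE : b <= g * (2 / eps) * v.
  have : 5 / p * (b / u) * (u * p / 5) <= 2 * g * (v * p / 5).
    apply: ler_pM => //.
    - exact/ltW.
    - by apply/ltW; rewrite !mulr_gt0 ?invr_gt0.
    - by rewrite ler_pM2r ?invr_gt0 // ler_pM2r.
  have -> : 5 / p * (b / u) * (u * p / 5) = b.
    by field; rewrite !gt_eqF.
  move/le_trans; apply.
  have -> : 2 * g * (v * p / 5) = g * v * 2 * (p / 5) by ring.
  have -> : g * (2 / eps) * v = g * v * 2 * eps^-1 by ring.
  rewrite ler_pM2l; last by rewrite !mulr_gt0.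
  by rewrite -[eps^-1]mul1r ler_pdivlMr //; lra.
have : alpha * (b + g * v) <= alpha * (g * (2 / eps) * v + g * v).
  by rewrite ler_pM2l; lra.
have -> : g * (alpha * (1 + 2 / eps) * v) = alpha * (g * (2 / eps) * v + g * v).
  by ring.
lra.
Qed.

Lemma ratio_accept (R : realFieldType) (alpha p a f1 f2 b u v g : R) :
  1 <= alpha -> 0 < p -> 0 < b -> 0 < u -> 0 < v -> 0 < g ->
  g <= 5 / p * (b / u) -> 0 < f2 ->
  f1 + g * f2 <= alpha * (b + g * v) ->
  alpha * (2 * p + 15) <= a -> v < 3 / 2 * u -> f1 <= a / (2 * p) * b.
Proof.
move=> alpha_ge1 p_gt0 b_gt0 u_gt0 v_gt0 g_gt0 g_le f2_gt0 approx a_ge v_lt.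
have gv : g * v <= 15 / (2 * p) * b.
  have : g * v <= 5 / p * (b / u) * (3 / 2 * u) by apply: ler_pM => //; lra.
  by have -> : 5 / p * (b / u) * (3 / 2 * u) = 15 / (2 * p) * b;
    first by field; rewrite !gt_eqF.
have : alpha * (b + g * v) <= alpha * (b + 15 / (2 * p) * b).
  by rewrite ler_pM2l; lra.
have -> : alpha * (b + 15 / (2 * p) * b) = alpha * (2 * p + 15) / (2 * p) * b.
  by field; rewrite gt_eqF.
have : alpha * (2 * p + 15) / (2 * p) * b <= a / (2 * p) * b.
  by rewrite ler_pM2r // ler_pM2r // invr_gt0; lra.
have : 0 < g * f2 by rewrite mulr_gt0.
lra.
Qed.

Lemma ratio_f1 (R : realFieldType) (alpha eps p a f1 b : R) :
  1 <= alpha -> 0 < p -> 0 < b -> 4 <= p * eps ->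
  a <= alpha * (2 * p + 15) + 1 ->
  f1 <= a / (2 * p) * b -> f1 <= alpha * (1 + 2 * eps) * b.
Proof.
move=> alpha_ge1 p_gt0 b_gt0 peps a_le /le_trans; apply; rewrite ler_pM2r //.
rewrite ler_pdivrMr; last by lra.
have : alpha * 4 <= alpha * (p * eps) by rewrite ler_pM2l //; lra.
nra.
Qed.

Local Open Scope nat_scope.

Lemma run_accept_id s r : r \notin [:: rP; rQ; rV; rW; rc; rt; ru] ->
  run accept s r = s r.
Proof.
rewrite !inE !negb_or.
do ![case/andP=> /negPf ?]; move=> /negPf ? /=.
by case: ifP => _ /=; do ![match goal with H : (r == _) = false |- _ => rewrite H end].
Qed.

Definition step_factor (ALG f1 : prog) : nat :=
  1 * (factor weight_code).+1 *
  (factor (call_setup ALG [:: 0; 1; 2; 3; 4; 5; 6; 7; 8; rgn; rgd])).+1 *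
  (factor save).+1 * (factor (call_setup f1 [:: 0; rx])).+1 * (factor accept).+1.

Lemma exec_scaled p s s' t f b T : exec p s s' t -> 0 < b ->
  bounded (b * T) s -> t <= f * (b * T) + T ->
  [/\ 0 < b * f.+1, b * T <= b * f.+1 * T, t <= b * f.+1 * T &
      bounded (b * f.+1 * T) s'].
Proof.
move=> E b0 sb tb; have tb' : t <= b * f.+1 * T.
  apply: leq_trans tb _; rewrite mulnS mulnDl addnC leq_add //; last by lia.
  by rewrite leq_pmull.
have bb : b * T <= b * f.+1 * T by rewrite leq_mul2r leq_pmulr ?orbT.
split=> //; first by rewrite muln_gt0 b0.
by apply: boundedW (bounded_exec E sb); rewrite geq_max tb' bb.
Qed.

Lemma exec_step ALG f1 s T ys zs t t' :
  bounded T s -> s rZ = 0 -> 0 < size ys <= 2 ->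
  returns ALG ([seq s r | r <- iota 0 9] ++ rat_code (weight (s rP) (s rQ))) ys t ->
  t <= T ->
  (nth 0 ys 0 != 0 -> [/\ size ys = 2, size zs = 2,
     returns f1 [:: s 0; nth 0 ys 1] zs t' & t' <= T]) ->
  exists s' t'', [/\ exec (step ALG f1) s s' t'', t'' <= 6 * (step_factor ALG f1 * T),
     forall i, i < size ys -> s' (rf + i) = nth 0 ys i,
     forall r, r < rP -> s' r = s r &
     if nth 0 ys 0 == 0 then s' rc = 0 else
     [/\ s' rP = s rP * 2, s' rQ = s rQ * 3, s' rV = s rV * 3, s' rW = s rW * 2 &
         s' rc = if nth 0 zs 0 * s rp * 2 * s 10 <= s ra * s 9 * nth 0 zs 1 then 0
                 else s rW * 2 + 1 - s rV * 3]].
Proof.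
move=> sT sZ /andP[ys0 ys2] retA tT retf.
have T_gt0 : 0 < T by apply: leq_trans (bitlen_gt0 _) (sT 0).
rewrite -(mul1n T) in sT.
have [code s1E] := run_weight s.
have [t1 E1 t1T] := @exec_run weight_code _ _ isT sT.
set s1 := run weight_code s in code s1E E1; clearbody s1.
have [b1 b1T {}t1T s1T] := exec_scaled E1 (isT : 0 < 1) sT (leq_trans t1T (leq_addr _ _)).
have s1Z : s1 rZ = 0 by rewrite s1E.
have args1 : [seq s1 r | r <- [:: 0; 1; 2; 3; 4; 5; 6; 7; 8; rgn; rgd]] =
    [seq s r | r <- iota 0 9] ++ rat_code (weight (s rP) (s rQ)).
  by rewrite -code /=; do 9!rewrite s1E //.
rewrite -args1 in retA.
have [s2 [t2 [E2 s2E s2D t2T]]] :=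
  exec_call (isT : all (fun r => r < D) [:: 0; 1; 2; 3; 4; 5; 6; 7; 8; rgn; rgd])
    s1Z ys2 s1T retA.
have [b2 b2T {}t2T s2T] :=
  exec_scaled E2 b1 s1T (leq_trans t2T (leq_add (leqnn _) tT)).
have s2Z : s2 rZ = 0 by rewrite s2E.
have [t3 E3 t3T] := @exec_run save _ _ isT s2T.
have s3E r : r != rf -> r != rx -> run save s2 r = s2 r.
  by move=> /negPf rf' /negPf rx' /=; rewrite rf' rx'.
have s3D i : i < size ys -> run save s2 (rf + i) = nth 0 ys i.
  move=> iys; case: i iys => [|[|i]] iys; last by lia.
    by rewrite /= s2Z addn0 -(s2D 0 iys).
  by rewrite /= s2Z addn0 -(s2D 1 iys).
set s3 := run save s2 in E3 s3E s3D; clearbody s3.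
have [b3 b3T {}t3T s3T] := exec_scaled E3 b2 s2T (leq_trans t3T (leq_addr _ _)).
have s3r r : r < rgn -> s3 r = s r.
  by move=> rgn_gt; rewrite s3E ?s2E ?s1E //; lia.
have s3f : s3 rf = nth 0 ys 0 by rewrite -(s3D 0).
set f4 := factor (call_setup f1 [:: 0; rx]).
set f5 := factor accept.
set b3' := (_ * (factor save).+1) in b3 b3T t3T s3T.
have b4T : b3' * T <= b3' * f4.+1 * T by rewrite leq_mul2r leq_pmulr ?orbT.
have b5T : b3' * f4.+1 * T <= b3' * f4.+1 * f5.+1 * T.
  by rewrite leq_mul2r leq_pmulr ?orbT.
have [ys00|ys00] := eqVneq (nth 0 ys 0) 0.
- eexists; exists (t1 + (t2 + (t3 + (bitlen (s3 rf) + bitlen 0)))); split.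
  + apply: ExecSeq E1 (ExecSeq E2 (ExecSeq E3 _)); apply: ExecIfFalse.
      by rewrite s3f ys00.
    exact: ExecConst.
  + rewrite -[step_factor ALG f1]/(b3' * f4.+1 * f5.+1) s3f ys00 [bitlen 0]/bitlen trunc_log0.
    have : 0 < b3' * T by rewrite muln_gt0 b3.
    lia.
  + move=> i iys; rewrite -s3D //=; have /negPf-> // : rf + i != rc by lia.
  + move=> r r_lt /=; have /negPf-> : r != rc by lia.
    by apply: s3r; lia.
  + by [].
have [ysz zsz retf1 t'T] := retf ys00.
have args3 : [seq s3 r | r <- [:: 0; rx]] = [:: s 0; nth 0 ys 1].
  by rewrite /= s3r // -(s3D 1) ?ysz.
rewrite -args3 in retf1.
have s3Z : s3 rZ = 0 by rewrite s3r.
have zs2 : size zs <= 2 by rewrite zsz.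
have [s4 [t4 [E4 s4E s4D t4T]]] :=
  exec_call (isT : all (fun r => r < D) [:: 0; rx]) s3Z zs2 s3T retf1.
have [b4 _ {}t4T s4T] :=
  exec_scaled E4 b3 s3T (leq_trans t4T (leq_add (leqnn _) t'T)).
have [t5 E5 t5T] := @exec_run accept _ _ isT s4T.
have [b5 _ {}t5T s5T] := exec_scaled E5 b4 s4T (leq_trans t5T (leq_addr _ _)).
have s4r r : r < rgn -> s4 r = s r by move=> r_lt; rewrite s4E ?s3r //; lia.
eexists; exists (t1 + (t2 + (t3 + (bitlen (s3 rf) + (t4 + t5))))); split.
- apply: ExecSeq E1 (ExecSeq E2 (ExecSeq E3 _)); apply: ExecIfTrue.
    by rewrite s3f.
  exact: ExecSeq E4 E5.
- rewrite -[step_factor ALG f1]/(b3' * f4.+1 * f5.+1); have := s3T rf.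
  by rewrite -/f4 -/f5 in t4T t5T; lia.
- move=> i iys; rewrite run_accept_id ?s4E ?s3D //; rewrite ysz in iys.
    by lia.
  by rewrite !inE; lia.
- by move=> r r_lt; rewrite run_accept_id ?s4r //; rewrite ?inE; lia.
- have [-> -> -> -> ->] := run_accept s4.
  by rewrite (s4D 0) ?(s4D 1) ?zsz // !s4r // (negPf ys00).
Qed.

Lemma codelen_cat xs ys : codelen (xs ++ ys) = codelen xs + codelen ys.
Proof. exact: big_cat. Qed.

Lemma bitlen_codelen xs x : x \in xs -> bitlen x <= codelen xs.
Proof. by move=> xin; rewrite /codelen (big_rem x) //= leq_addr. Qed.

Lemma bitlen_nth xs r : 0 < codelen xs -> bitlen (nth 0 xs r) <= codelen xs.
Proof.
move=> xs0; case: (ltnP r (size xs)) => rxs; first by rewrite bitlen_codelen ?mem_nth.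
by rewrite nth_default // /bitlen trunc_log0.
Qed.

Lemma leq_three_halves i v w : 0 < v -> v * 3 ^ i <= w * 2 ^ i -> i <= 2 * bitlen w.
Proof.
move=> v0 vw; have le_w : 3 ^ i <= w * 2 ^ i by apply: leq_trans vw; rewrite leq_pmull.
have : 8 ^ i <= w ^ 2 * 4 ^ i.
  have : (3 ^ i) ^ 2 <= (w * 2 ^ i) ^ 2 by rewrite leq_exp2r.
  rewrite expnMn -!expnM ![i * 2]mulnC !expnM; apply: leq_trans.
  by case: (i) => // j; rewrite leq_exp2r.
rewrite -[8]/(2 * 4) expnMn leq_pmul2r ?expn_gt0 // => w2.
have : 2 ^ i < 2 ^ (2 * bitlen w).
  apply: leq_ltn_trans w2 _; rewrite mulnC expnM ltn_exp2r //.
  exact: ltn_bitlen.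
by rewrite ltn_exp2l // => /ltnW.
Qed.

Lemma bitlen_exp3 i : bitlen (3 ^ i) <= (2 * i).+1.
Proof.
apply: bitlen_leq => //; apply: leq_ltn_trans (_ : 4 ^ i < _).
  by case: i => // i; rewrite leq_exp2r.
by rewrite -[4]/(2 ^ 2) -expnM ltn_exp2l.
Qed.

Local Open Scope ring_scope.

(** * Correctness and running time *)

Section Correctness.
Variables (R : realType) (Pi : bicriteria_problem) (alpha : R) (ALG : prog).

Local Notation f1_prog := (obj_prog Pi C1).

Definition oracle (I : inst Pi) (K T : nat) : Prop :=
  forall gamma, 0 < gamma -> (codelen (input I gamma) <= K)%N ->
  exists (o : option (sol Pi)) (t : nat),
    [/\ returns ALG (input I gamma) (sol_code o) t, (t <= T)%N &
      if o is Some x then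
        [/\ feasible I x, ratr (ws_obj I gamma x) <= alpha * ws_opt R I gamma &
          exists2 t', returns f1_prog [:: inst_enc I; sol_enc x]
                        (rat_code (obj C1 I x)) t' & (t' <= T)%N]
      else feasible I = set0].

Definition input_size (I : inst Pi) (B : rat) (p a : nat) : nat :=
  (codelen (input I B) + bitlen p + bitlen a)%N.

Record invariant (I : inst Pi) (B : rat) (p a i : nat) (s : store) : Prop := Invariant {
  inv_input : forall r, (r < 11)%N -> s r = nth 0%N (input I B) r;
  inv_zero : s rZ = 0%N;
  inv_p : s rp = p;
  inv_a : s ra = a;
  inv_P : s rP = (5 * num B * den (LB C2 I) * 2 ^ i)%N;
  inv_Q : s rQ = (p * den B * num (LB C2 I) * 3 ^ i)%N;
  inv_V : s rV = (den (UB C2 I) * num (LB C2 I) * 3 ^ i)%N;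
  inv_W : s rW = (num (UB C2 I) * den (LB C2 I) * 2 ^ i)%N;
  inv_cond : (0 < s rc <= s rW + 1)%N;
  inv_range : i = 0%N \/ (s rV <= s rW)%N;
  inv_scratch : forall r, (rgn + regs (step ALG f1_prog) <= r)%N -> s r = 0%N;
  inv_budget : forall x, feasible I x -> obj C1 I x <= B ->
    ratr (LB C2 I) * (3 / 2) ^+ i <= ratr (obj C2 I x) :> R }.

Lemma inv_index I B p a i s : invariant I B p a i s ->
  (i <= 2 * bitlen (num (UB C2 I) * den (LB C2 I)))%N.
Proof.
case=> _ _ _ _ _ _ -> -> _ [-> //|VW] _ _.
by apply: leq_three_halves VW; rewrite muln_gt0 den_gt0 num_gt0 // LB_gt0.
Qed.

Lemma inv_bounded I B p a i s : invariant I B p a i s ->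
  bounded (12 * input_size I B p a) (run (clear rgn (regs (step ALG f1_prog))) s).
Proof.
move=> inv; have index := inv_index inv; case: inv => sI s0 sp sa sP sQ sV sW sc _ ss _.
have K0 : (0 < codelen (input I B))%N by rewrite /codelen big_cons.
have in_len x : x \in input I B -> (bitlen x <= codelen (input I B))%N.
  exact: bitlen_codelen.
have [Bn [Bd [Ln [Ld [Un Ud]]]]] : (bitlen (num B) <= codelen (input I B) /\
    bitlen (den B) <= codelen (input I B) /\
    bitlen (num (LB C2 I)) <= codelen (input I B) /\
    bitlen (den (LB C2 I)) <= codelen (input I B) /\
    bitlen (num (UB C2 I)) <= codelen (input I B) /\
    bitlen (den (UB C2 I)) <= codelen (input I B))%N.
  by do ![split]; apply: in_len; rewrite !inE eqxx ?orbT.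
have b3 := bitlen_exp3 i; have b2 := bitlen_expn i.
have i_le : (i <= 4 * codelen (input I B))%N.
  by have := bitlen_muln (num (UB C2 I)) (den (LB C2 I)); lia.
have b5 : (bitlen 5 <= 3)%N by apply: bitlen_leq.
have P_le : (bitlen (s rP) <= 10 * input_size I B p a)%N.
  rewrite sP; apply: leq_trans (bitlen_muln _ _) _.
  have := bitlen_muln (5 * num B) (den (LB C2 I)); have := bitlen_muln 5 (num B).
  rewrite /input_size; lia.
have Q_le : (bitlen (s rQ) <= 12 * input_size I B p a)%N.
  rewrite sQ; apply: leq_trans (bitlen_muln _ _) _.
  have := bitlen_muln (p * den B) (num (LB C2 I)); have := bitlen_muln p (den B).
  rewrite /input_size; lia.
have V_le : (bitlen (s rV) <= 12 * input_size I B p a)%N.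
  rewrite sV; apply: leq_trans (bitlen_muln _ _) _.
  have := bitlen_muln (den (UB C2 I)) (num (LB C2 I)).
  rewrite /input_size; lia.
have W_le : (bitlen (s rW) <= 10 * input_size I B p a)%N.
  rewrite sW; apply: leq_trans (bitlen_muln _ _) _.
  have := bitlen_muln (num (UB C2 I)) (den (LB C2 I)).
  rewrite /input_size; lia.
have c_le : (bitlen (s rc) <= 12 * input_size I B p a)%N.
  case/andP: sc => _ /leq_bitlen /leq_trans; apply.
  apply: leq_trans (bitlen_addn _ _) _.
  have b1 : (bitlen 1 <= 1)%N by apply: bitlen_leq.
  by rewrite /input_size; rewrite /input_size in W_le; lia.
move=> r; rewrite run_clear; case: ifP => [_|/negbT].
  by rewrite /bitlen trunc_log0 /input_size; lia.
rewrite negb_or negb_and -leqNgt -ltnNge => /andP[/orP[r_lt|r_ge] rNZ]; last first.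
  by rewrite ss // /bitlen trunc_log0 /input_size; lia.
case: (ltnP r 11) => [r11|r11].
  by rewrite sI // (leq_trans (bitlen_nth _ K0)) // /input_size; lia.
have : r \in [:: rp; ra; rP; rQ; rV; rW; rc].
  by rewrite !inE; move: rNZ r11 r_lt; clear; lia.
rewrite !inE => /or4P[/eqP->|/eqP->|/eqP->|].
- by rewrite sp /input_size; lia.
- by rewrite sa /input_size; lia.
- by lia.
- by case/or4P=> /eqP-> //; lia.
Qed.

Lemma ws_opt_le (I : inst Pi) gamma x : 0 < gamma -> feasible I x ->
  ws_opt R I gamma <= ratr (ws_obj I gamma x).
Proof.
move=> g0 Fx; apply: ge_inf; last by exists x.
exists 0 => _ [y Fy <-]; rewrite ler0q addr_ge0 ?mulr_ge0 //; apply/ltW => //;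
  exact: obj_gt0.
Qed.

Lemma oracle_ratio (I : inst Pi) (B gamma : rat) x x' : 0 <= alpha -> 0 < gamma ->
  ratr (ws_obj I gamma x) <= alpha * ws_opt R I gamma ->
  feasible I x' -> obj C1 I x' <= B ->
  ratr (obj C1 I x) + ratr gamma * ratr (obj C2 I x) <=
    alpha * (ratr B + ratr gamma * ratr (obj C2 I x')) :> R.
Proof.
move=> a0 g0; rewrite /ws_obj rmorphD rmorphM /= => /le_trans H Fx' Bx'; apply: H.
rewrite ler_wpM2l // (le_trans (ws_opt_le g0 Fx')) //.
by rewrite /ws_obj rmorphD rmorphM /= lerD2r ler_rat.
Qed.

Lemma ratr_accept (q B : rat) (p a : nat) : 0 < q -> 0 < B -> (0 < p)%N ->
  (num q * p * 2 * den B <= a * num B * den q)%N =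
  (ratr q <= a%:R / (2 * p%:R) * ratr B :> R).
Proof.
move=> q0 B0 p0; rewrite !ratr_num_den //.
have dq : 0 < (den q)%:R :> R by rewrite ltr0n den_gt0.
have dB : 0 < (den B)%:R :> R by rewrite ltr0n den_gt0.
have p0' : 0 < 2 * p%:R :> R by rewrite mulr_gt0 // ltr0n.
rewrite ler_pdivrMr // -[RHS](ler_pM2r (mulr_gt0 p0' dB)).
have -> : a%:R / (2 * p%:R) * ((num B)%:R / (den B)%:R) * (den q)%:R *
    (2 * p%:R * (den B)%:R) = a%:R * (num B)%:R * (den q)%:R :> R.
  by field; rewrite (gt_eqF dB) pnatr_eq0 -lt0n.
by rewrite -(ler_nat R) !natrM; congr (_ <= _); ring.
Qed.

Lemma ratr_scaled_le (L U : rat) i : 0 < L -> 0 < U ->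
  (den U * num L * 3 ^ i <= num U * den L * 2 ^ i)%N =
  (ratr L * (3 / 2) ^+ i <= ratr U :> R).
Proof.
move=> L0 U0; rewrite !ratr_num_den // exprMn exprVn.
have dL : 0 < (den L)%:R :> R by rewrite ltr0n den_gt0.
have dU : 0 < (den U)%:R :> R by rewrite ltr0n den_gt0.
have e2 : 0 < 2 ^+ i :> R by rewrite exprn_gt0.
rewrite ler_pdivlMr // -[RHS](ler_pM2r (mulr_gt0 dL e2)).
have -> : (num L)%:R / (den L)%:R * (3 ^+ i / 2 ^+ i) * (den U)%:R *
    ((den L)%:R * 2 ^+ i) = (num L)%:R * 3 ^+ i * (den U)%:R :> R.
  by field; rewrite !gt_eqF.
by rewrite -(ler_nat R) !(natrM, natrX); congr (_ <= _); ring.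
Qed.

Lemma ratr_target (L B : rat) (p i : nat) : 0 < L -> 0 < B -> (0 < p)%N ->
  (5 * num B * den L * 2 ^ i)%N%:R / (p * den B * num L * 3 ^ i)%N%:R =
  5 / p%:R * (ratr B / (ratr L * (3 / 2) ^+ i)) :> R.
Proof.
move=> L0 B0 p0; rewrite !ratr_num_den // !(natrM, natrX) exprMn exprVn.
by field; rewrite ?expf_neq0 // ?pnatr_eq0 -?lt0n ?den_gt0 ?num_gt0 ?p0.
Qed.

Definition budget_output (I : inst Pi) (B : rat) (eps : R) (o : option (sol Pi)) : Prop :=
  if o is Some x then
    feasible I x /\
    forall x', feasible I x' -> obj C1 I x' <= B ->
      ratr (obj C1 I x) <= alpha * (1 + 2 * eps) * ratr B /\
      ratr (obj C2 I x) <= alpha * (1 + 2 / eps) * ratr (obj C2 I x')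
  else feasible I = set0.

Definition final_store (I : inst Pi) (B : rat) (eps : R) (s : store) : Prop :=
  s rZ = 0%N /\ exists2 o, budget_output I B eps o &
    forall j, (j < size (sol_code o))%N -> s (rf + j)%N = nth 0%N (sol_code o) j.

Definition body_factor : nat :=
  ((regs (step ALG f1_prog)).+2 + 6 * step_factor ALG f1_prog)%N.

Lemma rat_len_weight P Q L : (bitlen P <= L)%N -> (bitlen Q <= L)%N ->
  (rat_len (weight P Q) <= L.+2)%N.
Proof.
move=> PL QL; rewrite /rat_len rat_code_weight /codelen.
have b1 : (bitlen 1 <= 1)%N by apply: bitlen_leq.
have L0 : (0 < L)%N by apply: leq_trans PL.
case: ifP => _; rewrite !big_cons big_nil addn0.
- have := bitlen_addn (Q %/ P) 1; rewrite addn1.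
  by have := leq_bitlen (leq_div Q P); lia.
- by have := leq_bitlen (leq_div P Q); lia.
Qed.

Lemma exec_body (I : inst Pi) (B : rat) (p a : nat) (eps : R) T i s :
  1 <= alpha -> 0 < eps -> 0 < B -> (0 < p)%N ->
  4 <= p%:R * eps <= 5 ->
  alpha * (2 * p%:R + 15) <= a%:R <= alpha * (2 * p%:R + 15) + 1 ->
  (14 * input_size I B p a <= T)%N -> oracle I (14 * input_size I B p a) T ->
  invariant I B p a i s ->
  exists s' t, [/\ exec (body ALG f1_prog) s s' t,
    (bitlen (s rc) + t <= body_factor * T)%N &
    invariant I B p a i.+1 s' \/ s' rc = 0%N /\ final_store I B eps s'].
Proof.
move=> alpha1 eps0 B0 p0 /andP[p4 p5] /andP[a_ge a_le] KT orc inv.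
have s1b := inv_bounded inv.
have E1 := exec_clear rgn (regs (step ALG f1_prog)) s.
set s1 := run _ s in s1b E1.
have s1r r : (r < rgn)%N -> s1 r = s r.
  move=> r_lt; rewrite /s1 run_clear leqNgt r_lt /=.
  by case: eqVneq => // ->; rewrite (inv_zero inv).
have s1top r : (rgn + regs (step ALG f1_prog) <= r)%N -> s1 r = 0%N.
  by move=> r_ge; rewrite /s1 run_clear (inv_scratch inv) // if_same.
clearbody s1.
have s1T : bounded T s1 by apply: boundedW s1b; lia.
set g := weight (s1 rP) (s1 rQ).
have g0 : 0 < g := weight_gt0 _ _.
have gK : (codelen (input I g) <= 14 * input_size I B p a)%N.
  have := rat_len_weight (s1b rP) (s1b rQ); rewrite -/g.
  have := bitlen_gt0 p; have := bitlen_gt0 a.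
  by rewrite /input_size /input !codelen_cat -/(rat_len g); lia.
have [o [t [retA tT good]]] := orc g g0 gK.
have args : [seq s1 r | r <- iota 0 9] ++ rat_code (weight (s1 rP) (s1 rQ)) =
    input I g.
  by rewrite -/g /=; do 9!rewrite s1r ?(inv_input inv) //.
rewrite -args in retA.
have s1Z : s1 rZ = 0%N by rewrite s1r ?(inv_zero inv).
have s1I : s1 0%N = inst_enc I by rewrite s1r ?(inv_input inv).
have [zs zsE] : exists zs, zs = if o is Some x then rat_code (obj C1 I x) else [::].
  by eexists.
have ys12 : (0 < size (sol_code o) <= 2)%N by case: (o).
have [t' retf] : exists t', nth 0%N (sol_code o) 0 != 0%N ->
    [/\ size (sol_code o) = 2, size zs = 2,
       returns f1_prog [:: s1 0%N; nth 0%N (sol_code o) 1] zs t' & (t' <= T)%N].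
  rewrite zsE; case: (o) good => [x [_ _ [t' ret t'T]]|_]; last by exists 0%N.
  by exists t'; rewrite s1I.
have [s' [t'' [E' t''T s'D s'r s'E]]] := exec_step s1T s1Z ys12 retA tT retf.
have body_le : (bitlen (s rc) + ((regs (step ALG f1_prog)).+1 + t'') <=
    body_factor * T)%N.
  have := s1T rc; rewrite s1r // /body_factor.
  move: (step_factor _ _) (regs _) t''T (leq_trans (bitlen_gt0 _) (s1T 0%N)).
  by clear; nia.
exists s', ((regs (step ALG f1_prog)).+1 + t'')%N; split=> //.
  exact: ExecSeq E1 E'.
have s'Z : s' rZ = 0%N by rewrite s'r.
have final : budget_output I B eps o -> final_store I B eps s' by split=> //; exists o.
case: o good {args retA ys12} zsE retf s'D s'E final => [x|] good zsE retf s'D s'E final;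
  last by right; split=> //; apply: final.
case: good => Fx x_ws _; rewrite zsE in s'E; move: s'E => /= [s'P s'Q s'V s'W s'c].
rewrite !s1r // (inv_input inv (isT : 9 < 11)%N) (inv_input inv (isT : 10 < 11)%N)
  in s'P s'Q s'V s'W s'c.
rewrite [nth _ _ 9]/= [nth _ _ 10]/= (inv_p inv) (inv_a inv) in s'c.
have f10 := obj_gt0 C1 Fx; have f20 := obj_gt0 C2 Fx.
have L0 := LB_gt0 C2 I; have U0 := UB_gt0 C2 I.
rewrite ratr_accept // in s'c.
set u : R := ratr (LB C2 I) * (3 / 2) ^+ i.
have u0 : 0 < u by rewrite mulr_gt0 ?ltr0q ?exprn_gt0 ?divr_gt0.
have P0 : (0 < s1 rP)%N.
  by rewrite s1r // (inv_P inv) !muln_gt0 num_gt0 // den_gt0 expn_gt0.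
have Q0 : (0 < s1 rQ)%N.
  by rewrite s1r // (inv_Q inv) !muln_gt0 num_gt0 // den_gt0 expn_gt0 p0.
have [g_ge g_le] := weight_bounds R P0 Q0.
rewrite -/g !s1r // (inv_P inv) (inv_Q inv) ratr_target // -/u in g_ge g_le.
have p0R : 0 < p%:R :> R by rewrite ltr0n.
have B0R : 0 < ratr B :> R by rewrite ltr0q.
have g0R : 0 < ratr g :> R by rewrite ltr0q.
have f10R : 0 < ratr (obj C1 I x) :> R by rewrite ltr0q.
have f20R : 0 < ratr (obj C2 I x) :> R by rewrite ltr0q.
have ratio x' := oracle_ratio (le_trans ler01 alpha1) g0 x_ws (x' := x').
have [acc|rej] := boolP (ratr (obj C1 I x) <= a%:R / (2 * p%:R) * ratr B :> R).
  right; rewrite acc in s'c; split=> //; apply: final; split=> // x' Fx' Bx'; split.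
    exact: ratio_f1 acc.
  exact: ratio_f2 alpha1 eps0 p0R B0R u0 (inv_budget inv Fx' Bx') g_ge f10R p5
    (ratio _ _ Fx' Bx').
rewrite (negPf rej) in s'c.
have budget' x' : feasible I x' -> obj C1 I x' <= B ->
    ratr (LB C2 I) * (3 / 2) ^+ i.+1 <= ratr (obj C2 I x') :> R.
  move=> Fx' Bx'; rewrite exprS mulrCA -/u leNgt; apply: contra rej => v_lt.
  apply: ratio_accept alpha1 p0R B0R u0 _ g0R g_le f20R (ratio _ _ Fx' Bx') a_ge v_lt.
  by rewrite ltr0q obj_gt0.
have s'V' : s' rV = (den (UB C2 I) * num (LB C2 I) * 3 ^ i.+1)%N.
  by rewrite s'V (inv_V inv) expnSr mulnA.
have s'W' : s' rW = (num (UB C2 I) * den (LB C2 I) * 2 ^ i.+1)%N.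
  by rewrite s'W (inv_W inv) expnSr mulnA.
rewrite -s'V -s'W in s'c.
have [c0|c0] := eqVneq (s' rc) 0%N.
  right; split=> //; apply: final; split=> // x' Fx' Bx'.
  have : (s' rV <= s' rW)%N.
    rewrite s'V' s'W' ratr_scaled_le // (le_trans (budget' _ Fx' Bx')) // ler_rat.
    by case/andP: (LB_obj_UB C2 Fx').
  by move: s'c c0; clear; lia.
left; constructor=> //.
- move=> r r_lt; rewrite s'r ?s1r ?(inv_input inv) //.
    by apply: leq_trans r_lt _.
  by apply: leq_trans r_lt _.
- by rewrite s'r // s1r // (inv_p inv).
- by rewrite s'r // s1r // (inv_a inv).
- by rewrite s'P (inv_P inv) expnSr mulnA.
- by rewrite s'Q (inv_Q inv) expnSr mulnA.
- by move: s'c c0; clear; lia.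
- by right; move: s'c c0; clear; lia.
- move=> r r_ge; rewrite (exec_regs E') ?s1top //.
  by apply: leq_trans r_ge; rewrite leq_addl.
Qed.

Definition main_factor : nat := (6 * (2 + factor init + body_factor))%N.

Lemma exec_budget_prog (I : inst Pi) (B : rat) (p a : nat) (eps : R) T :
  1 <= alpha -> 0 < eps -> 0 < B -> (0 < p)%N ->
  4 <= p%:R * eps <= 5 ->
  alpha * (2 * p%:R + 15) <= a%:R <= alpha * (2 * p%:R + 15) + 1 ->
  (14 * input_size I B p a <= T)%N -> oracle I (14 * input_size I B p a) T ->
  exists o n t, [/\ budget_output I B eps o,
    returns (budget_prog ALG f1_prog p a) (input I B) (sol_code o) t,
    (t <= main_factor * n.+2 * T)%N, (n <= 4 * input_size I B p a)%N &
    n = 0%N \/ ratr (LB C2 I) * (3 / 2) ^+ n <= ratr (UB C2 I) :> R].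
Proof.
move=> alpha1 eps0 B0 p0 peps a_bounds KT orc.
have Ep := ExecConst rp p (load (input I B)).
have Ea := ExecConst ra a [eta load (input I B) with rp |-> p].
set s2 : store := [eta [eta load (input I B) with rp |-> p] with ra |-> a] in Ea.
have K0 : (0 < codelen (input I B))%N by rewrite /codelen big_cons.
have s2K : bounded (input_size I B p a) s2.
  move=> r; rewrite /s2 /=; case: ifP => [_|_]; first by rewrite /input_size; lia.
  case: ifP => [_|_]; first by rewrite /input_size; lia.
  by apply: leq_trans (bitlen_nth r K0) _; rewrite /input_size; lia.
have s2T : bounded T s2 by apply: boundedW s2K; lia.
have [ti Ei tiT] := @exec_run init _ _ isT s2T.
have inv0 : invariant I B p a 0 (run init s2).
  constructor=> //.
  - by do 11!case=> //.
  - by rewrite /= !muln1.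
  - by rewrite /= !muln1.
  - by rewrite /= !muln1.
  - by rewrite /= !muln1.
  - by rewrite /= addn1.
  - by left.
  - move=> r r_ge /=.
    have neq k : (k < rgn)%N -> (r == k) = false.
      by move=> k_lt; apply: gtn_eqF; apply: leq_trans k_lt (leq_trans (leq_addr _ _) r_ge).
    rewrite !neq // /s2 /= !neq // /load nth_default //.
    by apply: leq_trans (leq_trans (leq_addr _ _) r_ge).
  - move=> x Fx _; rewrite expr0 mulr1 ler_rat.
    by case/andP: (LB_obj_UB C2 Fx).
have while_hyp1 i s : invariant I B p a i s ->
    s rc != 0%N /\ (i < (2 * bitlen (num (UB C2 I) * den (LB C2 I))).+1)%N.
  move=> inv; split; last exact: inv_index inv.
  by case/andP: (inv_cond inv); rewrite lt0n.
have while_hyp2 i s := @exec_body I B p a eps T i s alpha1 eps0 B0 p0 peps a_bounds KT orc.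
have [n [s0 [s [tw [Ew [sZ [o good sD]] inv_n tw_le]]]]] :=
  exec_while while_hyp1 while_hyp2 inv0.
have sb : bounded (maxn T (ti + tw)) s := bounded_exec (ExecSeq Ei Ew) s2T.
have Ef := ExecOp 0 Add rf rZ s.
have Ex := ExecOp 1 Add rx rZ [eta s with 0%N |-> (s rf + s rZ)%N].
exists o, n, (bitlen p + (bitlen a + (ti + (tw + ((bitlen (s rf) + bitlen (s rZ)) +
  (bitlen (s rx) + bitlen (s rZ)))))))%N; split=> //.
- eexists; split.
    exact: ExecSeq Ep (ExecSeq Ea (ExecSeq Ei (ExecSeq Ew (ExecSeq Ef Ex)))).
  move=> j j_lt; rewrite -sD //.
  by case: (o) j_lt => [x|]; case: j => [|[|j]] //= _; rewrite sZ addn0.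
- have := sb rf; have := sb rx.
  have : (bitlen (s rZ) <= 1)%N by rewrite sZ /bitlen trunc_log0.
  have : (bitlen p + bitlen a <= T)%N by apply: leq_trans KT; rewrite /input_size; lia.
  have : (0 < T)%N by apply: leq_trans (s2T 0%N).
  move: tiT tw_le; rewrite /main_factor; move: (factor init) body_factor.
  move: (bitlen p) (bitlen a) (bitlen (s rf)) (bitlen (s rx)) (bitlen (s rZ)).
  clear; move=> bp ba bf bx bz fi fb tiT twT T0 pa z x f.
  have : (fi * T <= fi * T * n.+2)%N by rewrite leq_pmulr.
  have : (T <= T * n.+2)%N by rewrite leq_pmulr.
  have -> : (6 * (2 + fi + fb) * n.+2 * T = 12 * (T * n.+2) + 6 * (fi * T * n.+2) +
    6 * (n.+2 * (fb * T)))%N by ring.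
  by lia.
- apply: leq_trans (inv_index inv_n) _.
  have := bitlen_muln (num (UB C2 I)) (den (LB C2 I)).
  have in_len x : x \in input I B -> (bitlen x <= codelen (input I B))%N.
    exact: bitlen_codelen.
  have : (bitlen (num (UB C2 I)) <= codelen (input I B))%N.
    by apply: in_len; rewrite !inE eqxx ?orbT.
  have : (bitlen (den (LB C2 I)) <= codelen (input I B))%N.
    by apply: in_len; rewrite !inE eqxx ?orbT.
  by rewrite /input_size; lia.
- case: (inv_range inv_n) => [->|]; first by left.
  by rewrite (inv_V inv_n) (inv_W inv_n) ratr_scaled_le ?LB_gt0 ?UB_gt0 //; right.
Qed.

End Correctness.

Lemma leq_horner (q : {poly nat}) (x y : nat) : (x <= y)%N -> (q.[x] <= q.[y])%N.
Proof.
move=> xy; elim/poly_ind: q => [|q c IH]; first by rewrite !horner0.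
by rewrite !hornerMXaddC leq_add2r leq_mul.
Qed.

Lemma log2_three_halves (R : realType) (x : R) n :
  (3 / 2) ^+ n <= x -> n%:R <= 2 * log2 x.
Proof.
move=> nx; have x0 : 0 < x by apply: lt_le_trans nx; rewrite exprn_gt0 ?divr_gt0.
have ln20 : 0 < ln (2 : R) by apply: ln_gt0; rewrite ltr1n.
rewrite /log2 mulrA ler_pdivlMr // !mulr_natl -!lnXn //.
rewrite ler_ln ?posrE ?exprn_gt0 //; apply: le_trans (_ : ((3 / 2) ^+ n) ^+ 2 <= _).
  by rewrite exprAC lerXn2r ?nnegrE //; lra.
by rewrite lerXn2r ?nnegrE ?exprn_ge0 ?divr_ge0 //; exact: ltW.
Qed.

Lemma iteration_bound (R : realType) (L U : rat) n : 0 < L ->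
  n = 0%N \/ ratr L * (3 / 2) ^+ n <= ratr U :> R ->
  n.+2%:R <= 4 * Num.max 1 (log2 (ratr (U / L))) :> R.
Proof.
move=> L0; have L0R : 0 < ratr L :> R by rewrite ltr0q.
have max1 : 1 <= Num.max 1 (log2 (ratr (U / L))) :> R by rewrite le_max lexx.
case=> [->|]; first by lra.
rewrite mulrC -ler_pdivlMr // -fmorph_div /= => /log2_three_halves.
have : log2 (ratr (U / L)) <= Num.max 1 (log2 (ratr (U / L))) :> R.
  by rewrite le_max lexx orbT.
by rewrite -addn2 natrD; lra.
Qed.

(* An answer obtained for the right [u] satisfies [f1 x <= alpha * (2p + 15) / (2p) * B],
   and [4 <= p * eps] leaves room for rounding [alpha * (2p + 15)] up to an integer. *)
Definition eps_index (R : realType) (eps : R) : nat := Num.truncn (5 / eps).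

Definition threshold (R : realType) (alpha eps : R) : nat :=
  (Num.truncn (alpha * (2 * (eps_index eps)%:R + 15))).+1.

Lemma eps_index_bounds (R : realType) (eps : R) : 0 < eps -> eps <= 1 ->
  4 <= (eps_index eps)%:R * eps <= 5.
Proof.
move=> eps0 eps1; have /truncn_itv/andP[] : 0 <= 5 / eps by rewrite divr_ge0 // ltW.
rewrite -/(eps_index eps) ler_pdivlMr // => -> ; rewrite andbT.
have -> : (eps_index eps).+1%:R = (eps_index eps)%:R + 1 :> R by rewrite natr1.
by rewrite ltr_pdivrMr // mulrDl mul1r; lra.
Qed.

Lemma threshold_bounds (R : realType) (alpha eps : R) : 1 <= alpha ->
  alpha * (2 * (eps_index eps)%:R + 15) <= (threshold alpha eps)%:R <=
    alpha * (2 * (eps_index eps)%:R + 15) + 1.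
Proof.
move=> alpha1.
have x0 : 0 <= alpha * (2 * (eps_index eps)%:R + 15).
  by rewrite mulr_ge0 // ?addr_ge0 ?mulr_ge0 //; lra.
have /andP[xl xu] := truncn_itv x0.
by rewrite /threshold (ltW xu) /=; rewrite -(lerD2r 1) natr1 in xl.
Qed.

Lemma eps_index_gt0 (R : realType) (eps : R) : 0 < eps -> eps <= 1 ->
  (0 < eps_index eps)%N.
Proof.
move=> eps0 eps1; rewrite lt0n; apply/eqP => p0.
by have /andP[] := eps_index_bounds eps0 eps1; rewrite p0 mul0r; lra.
Qed.

Lemma bitlen_mul_pow2 k n : (bitlen (2 ^ k * n) <= k + bitlen n)%N.
Proof.
by apply: bitlen_leq; rewrite ?addn_gt0 ?orbT // expnD ltn_pmul2l ?expn_gt0 ?ltn_bitlen.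
Qed.

Lemma bitlen_eps_index (R : realType) (eps : R) : 0 < eps -> eps <= 1 ->
  (bitlen (eps_index eps) <= 4 + bitlen (Num.truncn eps^-1))%N.
Proof.
move=> eps0 eps1; apply: leq_trans (bitlen_mul_pow2 4 _); apply: leq_bitlen.
have i0 : 0 <= eps^-1 by rewrite invr_ge0 ltW.
have /andP[ml mu] := truncn_itv i0.
have m0 : (0 < Num.truncn eps^-1)%N by rewrite truncn_gt0 invf_ge1.
rewrite -(ler_nat R) natrM.
have /andP[pl _] : (eps_index eps)%:R <= 5 / eps < (eps_index eps).+1%:R.
  by apply: truncn_itv; rewrite mulr_ge0.
have : 1 <= (Num.truncn eps^-1)%:R :> R by rewrite ler1n.
by rewrite -natr1 in mu; rewrite (_ : (2 ^ 4)%:R = 16 :> R) //; lra.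
Qed.

Lemma bitlen_threshold (R : realType) (alpha eps : R) : 1 <= alpha ->
  0 < eps -> eps <= 1 ->
  (bitlen (threshold alpha eps) <=
    5 + (bitlen (Num.truncn alpha).+1 + bitlen (eps_index eps)))%N.
Proof.
move=> alpha1 eps0 eps1; have p0 := eps_index_gt0 eps0 eps1.
apply: leq_trans (_ : _ <= bitlen (2 ^ 5 * ((Num.truncn alpha).+1 * eps_index eps)))%N _.
  apply: leq_bitlen; rewrite -(ler_nat R).
  have /andP[_] := threshold_bounds eps alpha1; move/le_trans; apply.
  have /andP[_ Au] : (Num.truncn alpha)%:R <= alpha < (Num.truncn alpha).+1%:R.
    by apply: truncn_itv; lra.
  have p1 : 1 <= (eps_index eps)%:R :> R by rewrite ler1n.
  rewrite natrM [((Num.truncn alpha).+1 * _)%:R]natrM (_ : (2 ^ 5)%:R = 32 :> R) //.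
  move: (_.+1%:R) ((eps_index eps)%:R) Au p1 => A p Au p1.
  have : alpha * (2 * p + 15) <= A * (17 * p) by apply: ler_pM; lra.
  have : 1 <= A * p by apply: mulr_ege1; lra.
  lra.
by apply: leq_trans (bitlen_mul_pow2 _ _) _; rewrite leq_add2l bitlen_muln.
Qed.

Lemma rat_len_pow2 j : rat_len (2 ^ j)%N%:R = j.+2.
Proof.
by rewrite /rat_len rat_code_nat /codelen !big_cons big_nil bitlen_expn /bitlen trunc_log1
  addn1.
Qed.

Lemma codelen_input (Pi : bicriteria_problem) (I : inst Pi) q :
  codelen (input I q) = (codelen (inst_code I) + rat_len q)%N.
Proof. exact: codelen_cat. Qed.

(* [T] grows at least linearly, as the weights can have any encoding length. *)
Lemma ws_time_ge (Pi : bicriteria_problem) ALG T (I : inst Pi) K :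
  ws_time Pi ALG T -> (codelen (inst_code I) + 2 <= K)%N -> (K <= T K)%N.
Proof.
move=> [_ HT] IK; pose j := (K - codelen (inst_code I) - 2)%N.
have [|+ _ _] := HT I (2 ^ j)%N%:R; first by rewrite ltr0n expn_gt0.
rewrite codelen_input rat_len_pow2.
by have -> : (codelen (inst_code I) + j.+2 = K)%N by rewrite /j; lia.
Qed.

Lemma oracle_time (R : realType) (Pi : bicriteria_problem) (alpha : R) ALG T
    (I : inst Pi) K K' :
  ws_approx Pi alpha ALG -> ws_time Pi ALG T -> (K <= K')%N ->
  oracle alpha ALG I K (T K').
Proof.
move=> [_ [q HA]] [monoT HT] KK' gamma g0 gK.
have [o [t [ret _ good]]] := HA I gamma g0.
have [_ HtA Htf] := HT I gamma g0.
have TK : (T (codelen (input I gamma)) <= T K')%N by apply/monoT/(leq_trans gK).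
have run_of p xs ys u : returns p xs ys u -> runtime p xs u.
  by case=> s [E _]; exists s.
exists o, t; split=> //; first exact: leq_trans (HtA _ (run_of _ _ _ _ ret)) TK.
case: o ret good => [x|//] ret [Fx x_le]; split=> //.
have [qf Hf] := @obj_polytime Pi C1; have [t' ret' _] := Hf I x Fx.
exists t' => //; apply: leq_trans TK.
exact: Htf Fx ret C1 t' (run_of _ _ _ _ ret').
Qed.

Lemma oracle_poly (R : realType) (Pi : bicriteria_problem) (alpha : R) ALG :
  ws_approx Pi alpha ALG -> exists q : {poly nat}, forall (I : inst Pi) K,
    (K <= q.[K])%N /\ oracle alpha ALG I K q.[K].
Proof.
move=> [_ [qA HA]]; have [qf Hf] := @obj_polytime Pi C1.
exists ('X + qA + (qf \Po ('X + 'X + qA))) => I K.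
rewrite !hornerD horner_comp !hornerD !hornerX.
split; first by rewrite -addrA leq_addr.
move=> gamma g0 gK; have [o [t [ret tq good]]] := HA I gamma g0.
have len_le : (inst_len I + rat_len gamma <= K)%N.
  apply: leq_trans gK; rewrite codelen_input leq_add2r.
  by rewrite /codelen big_cons leq_addr.
have t_le : (t <= qA.[K])%N by apply: leq_trans tq (leq_horner _ _).
exists o, t; split=> //; first by rewrite -addrA addrCA (leq_trans t_le) // leq_addr.
case: o ret good => [x|//] [s [E sD]] [Fx x_le]; split=> //.
have [t' ret' t'q] := Hf I x Fx.
exists t' => //; apply: leq_trans t'q _; apply: leq_trans (leq_addl _ _).
apply: leq_horner; rewrite -addrA; apply: leq_add.
  by apply: leq_trans len_le; rewrite leq_addr.
have -> : sol_enc x = s 1%N by rewrite sD.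
apply: leq_trans (bitlen_exec _ E) _.
rewrite geq_max (leq_trans t_le) ?leq_addl // andbT.
apply: leq_trans (leq_addr _ _); apply: leq_trans gK.
by apply: bitlen_nth; rewrite /codelen big_cons.
Qed.

Lemma input_poly (Pi : bicriteria_problem) : exists q : {poly nat},
  forall (I : inst Pi) B, (codelen (input I B) <= q.[inst_len I + rat_len B])%N.
Proof.
have [q1 H1] := @LB_UB_len Pi C1; have [q2 H2] := @LB_UB_len Pi C2.
exists ('X + (q1 + q1) + (q2 + q2)) => I B.
have [L1 U1] := H1 I; have [L2 U2] := H2 I.
have m1 := leq_horner q1 (leq_addr (rat_len B) (inst_len I)).
have m2 := leq_horner q2 (leq_addr (rat_len B) (inst_len I)).
rewrite !hornerD !hornerX codelen_input /inst_code -cat1s !codelen_cat.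
have -> : codelen [:: inst_enc I] = inst_len I by rewrite /codelen big_seq1.
rewrite -!/(rat_len _); rewrite /inst_len in L1 L2 U1 U2 m1 m2 *.
move: L1 U1 L2 U2 m1 m2; clear.
rewrite -![GRing.add _ _]/(addn _ _).
lia.
Qed.

Lemma budget_opt_ge (R : realType) (Pi : bicriteria_problem) (I : inst Pi) (B : rat)
    (beta f : R) : 0 < beta ->
  (exists x, feasible I x /\ obj C1 I x <= B) ->
  (forall x, feasible I x -> obj C1 I x <= B -> f <= beta * ratr (obj C2 I x)) ->
  f <= beta * budget_opt R I B.
Proof.
move=> beta0 [x0 Fx0] f_le; rewrite -ler_pdivrMl //; apply: lb_le_inf.
  by exists (ratr (obj C2 I x0)); exists x0.
by move=> _ [x [Fx Bx] <-]; rewrite ler_pdivrMl // f_le.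
Qed.

Theorem theorem5 (R : realType) (Pi : bicriteria_problem) (alpha : R) (ALG : prog)
    (hALG : ws_approx Pi alpha ALG) :
  exists c k : nat, forall eps : R, 0 < eps -> eps <= 1 ->
  exists BUD : prog,
    budget_approx Pi (alpha * (1 + 2 * eps)) (alpha * (1 + 2 / eps)) BUD /\
    forall T : nat -> nat, ws_time Pi ALG T ->
    forall (I : inst Pi) (B : rat), 0 < B ->
    forall t : nat, runtime BUD (input I B) t ->
      t%:R <= c%:R
              * (T (k * (codelen (input I B) + bitlen (Num.truncn eps^-1)))%N)%:R
              * eps^-1
              * Num.max 1 (log2 (ratr (UB C2 I / LB C2 I))).
Proof.
have alpha1 : 1 <= alpha by case: hALG.
pose A0 := bitlen (Num.truncn alpha).+1.
exists (4 * main_factor Pi ALG)%N, (14 * (15 + A0))%N => eps eps0 eps1.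
pose p := eps_index eps; pose a := threshold alpha eps.
have p0 : (0 < p)%N := eps_index_gt0 eps0 eps1.
have peps := eps_index_bounds eps0 eps1.
have a_bounds := threshold_bounds eps alpha1.
have p_len : (bitlen p <= 4 + bitlen (Num.truncn eps^-1))%N := bitlen_eps_index eps0 eps1.
have a_len : (bitlen a <= 5 + (A0 + bitlen p))%N := bitlen_threshold alpha1 eps0 eps1.
have solve (I : inst Pi) B T (B0 : 0 < B) := @exec_budget_prog R Pi alpha ALG I B p a eps T
  alpha1 eps0 B0 p0 peps a_bounds.
exists (budget_prog ALG (obj_prog Pi C1) p a); split; last first.
- move=> T HT I B B0 t [s E].
  set K := (14 * (15 + A0) * _)%N.
  have size_le : (14 * input_size I B p a <= K)%N.
    rewrite /K /input_size -mulnA leq_mul2l /=.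
    have : (0 < codelen (input I B))%N by rewrite /codelen big_cons.
    have := bitlen_gt0 (Num.truncn eps^-1).
    by move: p_len a_len; clear; nia.
  have KT : (K <= T K)%N.
    apply: (ws_time_ge (I := I) HT); apply: leq_trans size_le.
    rewrite /input_size codelen_input.
    by have := bitlen_gt0 p; have := bitlen_gt0 a; clear; lia.
  have [o [n [t' [_ [s' [E' _]] t'_le _ n_le]]]] :=
    solve I B (T K) B0 (leq_trans size_le KT) (oracle_time hALG HT size_le).
  have [_ ->] := exec_det E E'.
  have := iteration_bound (LB_gt0 C2 I) n_le.
  set M := Num.max _ _ => n_le'.
  have eps_inv : 1 <= eps^-1 by rewrite invf_ge1.
  have M1 : 1 <= M by rewrite le_max lexx.
  apply: le_trans (_ : (main_factor Pi ALG * n.+2 * T K)%:R <= _).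
    by rewrite ler_nat.
  have -> : (main_factor Pi ALG * n.+2 * T K)%:R =
      (main_factor Pi ALG)%:R * (T K)%:R * n.+2%:R :> R by rewrite !natrM mulrAC.
  have -> : (4 * main_factor Pi ALG)%:R * (T K)%:R * eps^-1 * M =
      (main_factor Pi ALG)%:R * (T K)%:R * (4 * M * eps^-1) :> R.
    by rewrite natrM; ring.
  apply: ler_wpM2l; first by rewrite mulr_ge0.
  by rewrite (le_trans n_le') // ler_peMr // mulr_ge0 // (le_trans ler01).
- have beta1 : 1 <= alpha * (1 + 2 / eps).
    by apply: mulr_ege1 => //; rewrite lerDl divr_ge0 // ltW.
  split; first by apply: mulr_ege1 => //; rewrite lerDl; apply: mulr_ge0 => //; exact: ltW.
  split=> //.
  have [qi Hqi] := input_poly Pi; have [qo Hqo] := oracle_poly hALG.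
  pose S : {poly nat} := qi + (bitlen p + bitlen a)%N%:P.
  exists ((main_factor Pi ALG)%:P * (4%N%:P * S + 2%N%:P) * (qo \Po (14%N%:P * S)))
    => I B B0.
  have size_le : (input_size I B p a <= S.[inst_len I + rat_len B])%N.
    by rewrite hornerD hornerC /input_size -addnA leq_add2r Hqi.
  have [KT orc] := Hqo I (14 * input_size I B p a)%N.
  have [o [n [t [good ret t_le n_le _]]]] := solve I B _ B0 KT orc.
  exists o, t; split=> //.
    apply: leq_trans t_le _; rewrite !hornerM horner_comp hornerD !hornerM !hornerC.
    apply: leq_mul; last by apply: leq_horner; rewrite leq_mul2l size_le orbT.
    rewrite leq_mul2l -addn2 orbC; apply/orP; left; apply: leq_add => //.
    by apply: leq_trans n_le _; rewrite leq_mul2l size_le orbT.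
  case: o good {ret} => [x [Fx x_good]|//]; split=> // ex.
  split; first by have [x' [Fx' Bx']] := ex; have [] := x_good x' Fx' Bx'.
  apply: budget_opt_ge => //; first exact: lt_le_trans ltr01 beta1.
  by move=> x' Fx' Bx'; have [] := x_good x' Fx' Bx'.
Qed.
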